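(* Let $m\ge2$ and let $a_1,a_2,b_1,b_2,b_3,c_1,\dots,c_{2m+1}\in\mathbb{C}$ with $a_1\ne a_2$, $b_1,b_2,b_3$ pairwise distinct, $c_1,\dots,c_{2m+1}$ pairwise distinct, and $(m+1)a_1+ma_2=b_1+mb_2+mb_3+\sum_{i=1}^{2m+1}c_i$. Let ${\bf B},{\bf C}$ be the $(2m+1)\times(2m+1)$ matrices of the odd family defined in the context. Then ${\bf A}={\bf B}+{\bf C}$ is diagonalizable, with eigenvalue $a_1$ of multiplicity $m+1$ and $a_2$ of multiplicity $m$.
   Context: Notation: $p_i^{jk}=c_i+b_j-a_k$, $q_{ij}=c_i+c_j+b_2+b_3-a_1-a_2$; empty products are $1$. ${\bf B}$ has $B_{11}=b_1$, $B_{1+i,1+i}=b_2$ and $B_{m+1+i,m+1+i}=b_3$ ($1\le i\le m$), $B_{1,1+j}=(-1)^{m-j}p^{21}_{2m+1-j}\frac{\prod_{k=j+1}^m q_{k,2m+1-j}}{\prod_{k=m+1}^{2m-j}(c_k-c_{2m+1-j})}$ ($1\le j\le m$), $B_{1,m+1+j}=(-1)^{m-j}p^{31}_{m+1-j}\frac{\prod_{k=m+1+j}^{2m}q_{m+1-j,k}}{\prod_{k=1}^{m-j}(c_k-c_{m+1-j})}$ ($1\le j\le m$), $B_{1+i,m+1+j}=(-1)^{m-j}p^{31}_{m+1-j}\frac{\prod_{k=1,k\ne m+1-j}^{i}q_{k,2m+1-i}\prod_{k=m+1+j,k\ne2m+1-i}^{2m}q_{m+1-j,k}}{\prod_{k=2m+2-i}^{2m}(c_{2m+1-i}-c_k)\prod_{k=1}^{m-j}(c_k-c_{m+1-j})}$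 ($1\le i,j\le m$), all other entries $0$. ${\bf C}$ has $C_{11}=c_{2m+1}$, $C_{1+i,1+i}=c_{2m+1-i}$, $C_{m+1+i,m+1+i}=c_{m+1-i}$ ($1\le i\le m$), $C_{1+i,1}=-\frac{\prod_{k=1}^i q_{k,2m+1-i}}{\prod_{k=2m+2-i}^{2m}(c_{2m+1-i}-c_k)}$ ($1\le i\le m$), $C_{m+1+i,1}=-\frac{\prod_{k=m+1}^{m+i}q_{m+1-i,k}}{\prod_{k=m+2-i}^m(c_{m+1-i}-c_k)}$ ($1\le i\le m$), $C_{m+1+i,1+j}=(-1)^{m-j}p^{21}_{2m+1-j}\frac{\prod_{k=m+1,k\ne2m+1-j}^{m+i}q_{m+1-i,k}\prod_{k=j+1,k\ne m+1-i}^m q_{k,2m+1-j}}{\prod_{k=m+2-i}^m(c_{m+1-i}-c_k)\prod_{k=m+1}^{2m-j}(c_k-c_{2m+1-j})}$ ($1\le i,j\le m$), all other entries $0$. *)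

(* Defs.v *)
From mathcomp Require Import all_boot all_order all_algebra.
Set Implicit Arguments. Unset Strict Implicit. Unset Printing Implicit Defensive.
Import Order.TTheory GRing.Theory Num.Theory.
Local Open Scope ring_scope.

(* Indices follow the paper: 1-based naturals.  c : nat -> C, only c 1 .. c (2m+1) matter.
   Row/column r (1 <= r <= 2m+1) of the paper is the ordinal r-1. *)

Section OddFamily.
Variables (C : fieldType) (m : nat) (a1 a2 b1 b2 b3 : C) (c : nat -> C).

Definition p21 (i : nat) : C := c i + b2 - a1.
Definition p31 (i : nat) : C := c i + b3 - a1.
Definition qq (i j : nat) : C := c i + c j + b2 + b3 - a1 - a2.

Definition B1a (j : nat) : C :=
  (-1) ^+ (m - j)%N * p21 (2 * m+1-j)%N
  * (\prod_(j+1 <= k < m+1) qq k (2 * m+1-j)%N)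
  / (\prod_(m+1 <= k < 2 * m-j+1) (c k - c (2 * m+1-j)%N)).

Definition B1b (j : nat) : C :=
  (-1) ^+ (m - j)%N * p31 (m+1-j)%N
  * (\prod_(m+1+j <= k < 2 * m+1) qq (m+1-j)%N k)
  / (\prod_(1 <= k < m-j+1) (c k - c (m+1-j)%N)).

Definition Bij (i j : nat) : C :=
  (-1) ^+ (m - j)%N * p31 (m+1-j)%N
  * ((\prod_(1 <= k < i+1 | k != (m+1-j)%N) qq k (2 * m+1-i)%N)
     * (\prod_(m+1+j <= k < 2 * m+1 | k != (2 * m+1-i)%N) qq (m+1-j)%N k))
  / ((\prod_(2 * m+2-i <= k < 2 * m+1) (c (2 * m+1-i)%N - c k))
     * (\prod_(1 <= k < m-j+1) (c k - c (m+1-j)%N))).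

Definition Bnat (r s : nat) : C :=
  if (r == 1%N) && (s == 1%N) then b1
  else if (r == s) && (2 <= r <= m+1)%N then b2
  else if (r == s) && (m+2 <= r <= 2 * m+1)%N then b3
  else if (r == 1%N) && (2 <= s <= m+1)%N then B1a (s - 1)%N
  else if (r == 1%N) && (m+2 <= s <= 2 * m+1)%N then B1b (s - m - 1)%N
  else if (2 <= r <= m+1)%N && (m+2 <= s <= 2 * m+1)%N then Bij (r - 1)%N (s - m - 1)%N
  else 0.

Definition C1a (i : nat) : C :=
  - (\prod_(1 <= k < i+1) qq k (2 * m+1-i)%N)
  / (\prod_(2 * m+2-i <= k < 2 * m+1) (c (2 * m+1-i)%N - c k)).

Definition C1b (i : nat) : C :=
  - (\prod_(m+1 <= k < m+i+1) qq (m+1-i)%N k)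
  / (\prod_(m+2-i <= k < m+1) (c (m+1-i)%N - c k)).

Definition Cij (i j : nat) : C :=
  (-1) ^+ (m - j)%N * p21 (2 * m+1-j)%N
  * ((\prod_(m+1 <= k < m+i+1 | k != (2 * m+1-j)%N) qq (m+1-i)%N k)
     * (\prod_(j+1 <= k < m+1 | k != (m+1-i)%N) qq k (2 * m+1-j)%N))
  / ((\prod_(m+2-i <= k < m+1) (c (m+1-i)%N - c k))
     * (\prod_(m+1 <= k < 2 * m-j+1) (c k - c (2 * m+1-j)%N))).

Definition Cnat (r s : nat) : C :=
  if (r == 1%N) && (s == 1%N) then c (2 * m+1)%N
  else if (r == s) && (2 <= r <= m+1)%N then c (2 * m+1-(r-1))%N
  else if (r == s) && (m+2 <= r <= 2 * m+1)%N then c (m+1-(r-m-1))%N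
  else if (2 <= r <= m+1)%N && (s == 1%N) then C1a (r - 1)%N
  else if (m+2 <= r <= 2 * m+1)%N && (s == 1%N) then C1b (r - m - 1)%N
  else if (m+2 <= r <= 2 * m+1)%N && (2 <= s <= m+1)%N then Cij (r - m - 1)%N (s - 1)%N
  else 0.

Definition Bmx : 'M[C]_(2 * m+1) := \matrix_(i, j) Bnat i.+1 j.+1.
Definition Cmx : 'M[C]_(2 * m+1) := \matrix_(i, j) Cnat i.+1 j.+1.

End OddFamily.

(* Main.v *)
Require Import Defs.
From mathcomp Require Import ring zify.
From mathcomp Require Import all_boot all_order all_algebra.
Import Order.TTheory GRing.Theory Num.Theory.
Local Open Scope ring_scope.

(** Write [x_j] and [y_i] for the two halves of [c_1, ..., c_2m], listed
backwards, and [t = b_1 + c_(2m+1)].  Then [A = B + C] is a bordered Cauchy-like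
matrix with blocks [t], [diag (b_2 + y_i)], [diag (b_3 + x_j)]: its borders are
[al, be] (for [y]) and [ga, de] (for [x]), and its remaining blocks are
[- al_i de_j / q_ij] and [- ga_j be_i / q_ij] with [q_ij = x_j + y_i + s], where the
factor [q_ij] formally cancels, so that nothing is divided by it.  The products
[al_i be_i] and [ga_j de_j] are the residues of the partial fraction expansions
of [(z + b_3 - a_1) f(z) / g(z)] and of its counterpart with [f] and [g] exchanged,
where [g] vanishes at the [x_j] and [f] at the [- y_i - s].  Lagrange
interpolation therefore evaluates every entry of [A^2] and gives
[(A - a_1) (A - a_2) = 0].  Hence [A] is diagonalizable, and as [a_1 <> a_2] in
characteristic zero its trace determines the multiplicities. *)

Set Implicit Arguments. Unset Strict Implicit. Unset Printing Implicit Defensive.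

(** * Linear algebra of matrices annihilated by a quadratic with distinct roots *)

Lemma char_poly_conj (F : fieldType) n (P A : 'M[F]_n) : P \in unitmx ->
  char_poly (invmx P *m A *m P) = char_poly A.
Proof.
move=> uP; rewrite /char_poly /char_poly_mx.
have PE : map_mx polyC (invmx P) *m map_mx polyC P = 1%:M.
  by rewrite -map_mxM mulVmx // map_mx1.
have -> : 'X%:M - map_mx polyC (invmx P *m A *m P) =
  map_mx polyC (invmx P) *m ('X%:M - map_mx polyC A) *m map_mx polyC P.
  by rewrite !map_mxM mulmxBr mulmxBl scalar_mxC -(mulmxA 'X%:M) PE mulmx1.
by rewrite !det_mulmx mulrAC -det_mulmx PE det1 mul1r.
Qed.

(** The minimal polynomial divides a product of two distinct linear factors. *)
Lemma diagonalizable_quadratic (F : fieldType) n (A : 'M[F]_n) (a b : F) :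
  a != b -> (A - a%:M) *m (A - b%:M) = 0 -> diagonalizable A.
Proof.
case: n A => [|n] A ab A0.
  (* The minimal polynomial is used in positive dimension, so the empty matrix is treated apart. *)
  by exists 1%:M; rewrite ?unitmx1 //; apply/is_diag_mxP => - [].
apply/diagonalizableP; exists [:: a; b]; first by rewrite /= inE ab.
apply: mxminpoly_min.
by rewrite !big_cons big_nil mulr1 rmorphM !rmorphB /= horner_mx_X !horner_mx_C.
Qed.

(** After diagonalization every diagonal entry is [a] or [b], and in characteristic zero the trace
    determines how many of them are [a]. *)
Lemma char_poly_quadratic (F : numFieldType) n k l (A : 'M[F]_n) (a b : F) :
  a != b -> (A - a%:M) *m (A - b%:M) = 0 ->
  n = (k + l)%N -> \tr A = k%:R * a + l%:R * b ->
  char_poly A = ('X - a%:P) ^+ k * ('X - b%:P) ^+ l.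
Proof.
move=> ab A0 nE trA; have [P uP] := diagonalizable_quadratic ab A0.
move=> /(diagonalizable_forLR uP)[d AE]; rewrite mxpoly.conjVmx // in AE.
have dE i : (d 0 i == a) || (d 0 i == b).
  (* Conjugation makes the quadratic relation diagonal, so it can be read off one diagonal entry at
     a time. *)
  have PD : P *m (A - a%:M) *m ((A - b%:M) *m invmx P) =
            (diag_mx d - a%:M) *m (diag_mx d - b%:M).
    have E c : A - c%:M = invmx P *m (diag_mx d - c%:M) *m P.
      by rewrite AE mulmxBr mulmxBl scalar_mxC -(mulmxA c%:M) mulVmx // mulmx1.
    rewrite !E -!mulmxA mulmxV // mulmx1 !mulmxA mulmxV // mul1mx.
    by rewrite -(mulmxA _ P) mulmxV // mulmx1.
  have : P *m (A - a%:M) *m ((A - b%:M) *m invmx P) = 0.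
    by rewrite !mulmxA -(mulmxA P) A0 mulmx0 mul0mx.
  rewrite PD -!diag_const_mx -!raddfB mulmx_diag => /matrixP/(_ i i)/eqP.
  by rewrite !mxE eqxx mulr1n mulf_eq0 !subr_eq0.
rewrite AE char_poly_conj // char_poly_trig ?diag_mx_is_trig //.
have dU i : d 0 i = if d 0 i == a then a else b.
  by case: eqP (dE i) => [//|_ /eqP].
set S := [pred i | d 0 i == a].
have cS : (#|S| + #|[predC S]|)%N = n by rewrite cardC card_ord.
have trS : \tr A = #|S|%:R * a + #|[predC S]|%:R * b.
  rewrite AE mxtrace_mulC mulmxA mulmxV // mul1mx mxtrace_diag.
  rewrite (bigID S) /= !mulr_natl -!sumr_const; congr (_ + _).
    by apply: eq_bigr => i /eqP.
  by apply: eq_bigr => i /negbTE ia; rewrite dU ia.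
have kS : #|S| = k.
  apply/eqP; rewrite -(eqr_nat F) -subr_eq0.
  (* Expressing [l] and the size of the complement of [S] through [n] turns the trace identity into
     this single equation. *)
  have : (#|S|%:R - k%:R) * (a - b) = 0.
    have lE : l%:R = n%:R - k%:R :> F by rewrite nE natrD addrC addKr.
    have SE : #|[predC S]|%:R = n%:R - #|S|%:R :> F.
      by have := congr1 (fun p => p%:R : F) cS; rewrite natrD => <-; rewrite addrC addKr.
    move: trS; rewrite trA lE SE => E.
    have -> : (#|S|%:R - k%:R) * (a - b) =
      #|S|%:R * a + (n%:R - #|S|%:R) * b - (k%:R * a + (n%:R - k%:R) * b) by ring.
    by rewrite -E subrr.
  by move=> /eqP; rewrite mulf_eq0 [a - b == 0]subr_eq0 (negbTE ab) orbF.
have lS : #|[predC S]| = l by lia.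
rewrite (bigID S) /= -kS -lS -!prodr_const; congr (_ * _).
  by apply: eq_bigr => i /eqP; rewrite mxE eqxx mulr1n => ->.
by apply: eq_bigr => i /negbTE ia; rewrite mxE eqxx mulr1n dU ia.
Qed.

(** * Split polynomials and Lagrange interpolation *)

Lemma size_prod_XsubC_pred (F : fieldType) (I : finType) (P : pred I) (x : I -> F) :
  size (\prod_(i | P i) ('X - (x i)%:P)) = #|P|.+1.
Proof. by rewrite -big_enum /= size_prod_XsubC -cardE. Qed.

Lemma coef_prod_XsubC_pred (F : fieldType) (I : finType) (P : pred I) (x : I -> F) :
  (\prod_(i | P i) ('X - (x i)%:P))`_#|P| = 1.
Proof.
have /monicP := monic_prod_XsubC (index_enum I) P x.
by rewrite /lead_coef size_prod_XsubC_pred.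
Qed.

Lemma coef_pred_prod_XsubC (F : fieldType) (I : finType) (P : pred I) (x : I -> F) n :
  #|P| = n.+1 ->
  (\prod_(i | P i) ('X - (x i)%:P))`_n = - \sum_(i | P i) x i.
Proof.
move=> cP; rewrite -[LHS]/(_`_n) -big_enum -[in RHS]big_enum /=.
rewrite -(big_map x predT (fun c => 'X - c%:P)).
have sE : size [seq x i | i <- enum P] = n.+1 by rewrite size_map -cardE.
have := @coefPn_prod_XsubC F [seq x i | i <- enum P].
by rewrite sE /= => ->//; rewrite big_map.
Qed.

Section Lagrange.
Variables (F : fieldType) (m : nat) (x : 'I_m -> F).
Hypothesis x_inj : injective x.

Definition node_weight (j : 'I_m) : F := \prod_(k | k != j) (x j - x k).

Lemma node_weight_neq0 j : node_weight j != 0.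
Proof.
apply/prodf_neq0 => k kj; rewrite subr_eq0.
by apply: contra kj => /eqP/x_inj ->.
Qed.

Lemma card_neq_ord (j : 'I_m) : #|[pred k | k != j]| = m.-1.
Proof. by have := cardC1 j; rewrite card_ord => <-; apply: eq_card => k; rewrite !inE. Qed.

(** The difference of the two sides has size at most [m] but vanishes at [m] distinct nodes. *)
Lemma lagrange_interpolation (P : {poly F}) : (size P <= m)%N ->
  P = \sum_j (P.[x j] / node_weight j) *: \prod_(k | k != j) ('X - (x k)%:P).
Proof.
move=> sP; apply/eqP; rewrite -subr_eq0; apply/negPn/negP => nz.
set Q := (X in X != 0) in nz.
have : (size [seq x j | j <- enum 'I_m] < size Q)%N.
  apply: max_poly_roots => //.
    apply/allP => _ /mapP [j _ ->]; rewrite /root /Q !hornerE horner_sum.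
    rewrite (bigD1 j) //= [X in _ - (_ + X)]big1 ?addr0.
      rewrite !hornerE horner_prod.
      under eq_bigr do rewrite hornerXsubC.
      by rewrite -/(node_weight j) divfK ?node_weight_neq0 // subrr.
    move=> k kj; rewrite !hornerE horner_prod (bigD1 j) 1?eq_sym //=.
    by rewrite hornerXsubC subrr mul0r mulr0.
  by rewrite map_inj_uniq ?enum_uniq.
rewrite size_map size_enum_ord ltnNge => /negP; apply.
apply: (leq_trans (size_polyD _ _)); rewrite size_polyN geq_max sP /=.
apply: (leq_trans (size_sum _ _ _)); apply/bigmax_leqP => j _.
apply: (leq_trans (size_scale_leq _ _)); rewrite size_prod_XsubC_pred card_neq_ord.
by have := ltn_ord j; lia.
Qed.

Lemma lagrange_horner (P : {poly F}) z : (size P <= m)%N ->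
  P.[z] = \sum_j P.[x j] / node_weight j * \prod_(k | k != j) (z - x k).
Proof.
move=> sP; rewrite {1}(lagrange_interpolation sP) horner_sum.
apply: eq_bigr => j _; rewrite hornerZ horner_prod.
by under eq_bigr do rewrite hornerXsubC.
Qed.

(** Each basis product is monic of degree [m - 1], so only its scalar survives in that coefficient.
    Most sums over the nodes below are evaluated this way. *)
Lemma lagrange_coef (P : {poly F}) : (size P <= m)%N ->
  \sum_j P.[x j] / node_weight j = P`_m.-1.
Proof.
move=> sP; rewrite {2}(lagrange_interpolation sP) coef_sum.
apply: eq_bigr => j _; rewrite coefZ.
by have := coef_prod_XsubC_pred [pred k | k != j] x; rewrite card_neq_ord => ->; rewrite mulr1.
Qed.

End Lagrange.

(* [sel S Q i] keeps the factors of row [i] selected by [S], and [selx S Q i k]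
   drops the factor [k] from it.  Exactly one of row [i] (selected by [S]) and
   column [j] (selected by the complement [N]) carries [Q i j]; hence removing
   [Q i j] from both divides their product by [Q i j] exactly once. *)
Section Staircase.
Variable F : comNzRingType.

Definition sel (I J : finType) (S : I -> J -> bool) (Q : I -> J -> F) i :=
  \prod_(j | S i j) Q i j.

Definition selx (I J : finType) (S : I -> J -> bool) (Q : I -> J -> F) i k :=
  \prod_(j | S i j && (j != k)) Q i j.

Lemma sel_split (I J : finType) (S : I -> J -> bool) (Q : I -> J -> F) i k :
  sel S Q i = (if S i k then Q i k else 1) * selx S Q i k.
Proof.
rewrite /sel /selx; case: ifP => Sk; first by rewrite (bigD1 k).
rewrite mul1r; apply: eq_bigl => j; case: eqP => [->|]; first by rewrite Sk.
by rewrite andbT.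
Qed.

Variables (I J : finType) (S N : I -> J -> bool) (Q : I -> J -> F).
Hypothesis NS : forall i j, N i j = ~~ S i j.
Let St j i := S i j.
Let Nt j i := N i j.
Let Qt j i := Q i j.

Lemma selx_mulC i j : selx S Q i j * selx N Q i j = \prod_(k | k != j) Q i k.
Proof.
rewrite [RHS](bigID (S i)) /=; congr (_ * _); apply: eq_bigl => k.
  by rewrite andbC.
by rewrite NS andbC.
Qed.

Lemma selxt_mulC i j : selx St Qt j i * selx Nt Qt j i = \prod_(k | k != i) Q k j.
Proof.
rewrite [RHS](bigID (S^~ j)) /=; congr (_ * _); apply: eq_bigl => k.
  by rewrite andbC.
by rewrite /Nt NS andbC.
Qed.

Lemma sel_off_corner i j :
  sel S Q i * sel Nt Qt j = selx S Q i j * selx Nt Qt j i * Q i j.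
Proof.
rewrite (sel_split S Q i j) (sel_split Nt Qt j i) /Nt NS /Qt.
by case: (S i j) => /=; ring.
Qed.

(** The column of [N] carries [Q i j] exactly when row [i] of [N] needs it. Handing it over
    completes that row, which no longer depends on [j] and can leave a sum over [j]. *)
Lemma sel_row i j :
  sel Nt Qt j * (selx St Qt j i * selx N Q i j) =
  \prod_(k | k != i) Q k j * sel N Q i.
Proof.
rewrite (sel_split N Q i j) (sel_split Nt Qt j i) -selxt_mulC /Nt NS /Qt.
by case: (S i j) => /=; ring.
Qed.

Lemma sel_diag i j :
  selx S Q i j * selx Nt Qt j i * (selx St Qt j i * selx N Q i j) =
  \prod_(k | k != i) Q k j * \prod_(k | k != j) Q i k.
Proof. by rewrite -selxt_mulC -selx_mulC; ring. Qed.

(** Each of the two columns lacks only one of the rows [i] and [l], so it can supply the factor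
    missing from the other one. What remains of the columns avoids both rows. *)
Lemma sel_offdiag i l j : i != l ->
  selx S Q i j * selx Nt Qt j i * (selx St Qt j l * selx N Q l j) =
  sel S Q i * sel N Q l * \prod_(k | (k != i) && (k != l)) Q k j.
Proof.
move=> il; rewrite (sel_split S Q i j) (sel_split N Q l j).
have dropl (T : I -> J -> bool) r s : r != s ->
    selx (fun j i => T i j) Qt j r =
    (if T s j then Q s j else 1) * \prod_(k | T k j && (k != r) && (k != s)) Q k j.
  move=> rs; rewrite /selx; case: ifP => Ts; first by rewrite (bigD1 s) //= Ts eq_sym rs.
  rewrite mul1r; apply: eq_bigl => k; case: (k =P s) => [->|_]; first by rewrite Ts.
  by rewrite andbT.
rewrite (dropl N i l) // (dropl S l i) 1?eq_sym // [X in _ = _ * X](bigID (S^~ j)) /=.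
have -> : \prod_(k | ((k != i) && (k != l)) && S k j) Q k j =
          \prod_(k | S k j && (k != l) && (k != i)) Q k j.
  by apply: eq_bigl => k; rewrite [RHS]andbC andbA [RHS]andbAC.
have -> : \prod_(k | ((k != i) && (k != l)) && ~~ S k j) Q k j =
          \prod_(k | N k j && (k != i) && (k != l)) Q k j.
  by apply: eq_bigl => k; rewrite NS andbC andbA.
ring.
Qed.
End Staircase.

(** * Partial fraction sums over the nodes *)

Section PartialFractions.
Variables (F : fieldType) (m : nat) (x y : 'I_m -> F) (s h : F).
Hypothesis x_inj : injective x.
Hypothesis m_gt1 : (1 < m)%N.

Let z i := - (y i + s).
Let G : {poly F} := \prod_j ('X - (x j)%:P).
Let Fz (P : pred 'I_m) : {poly F} := \prod_(i | P i) ('X - (z i)%:P).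

Let hornerG j : G.[x j] = 0.
Proof. by rewrite horner_prod (bigD1 j) //= hornerXsubC subrr mul0r. Qed.

Let hornerFz P a : (Fz P).[a] = \prod_(i | P i) (a + (y i + s)).
Proof.
by rewrite horner_prod; apply: eq_bigr => i _; rewrite hornerXsubC opprK.
Qed.

Let sizeG : size G = m.+1.
Proof. by rewrite size_prod_XsubC_pred card_ord. Qed.

Let monicG : G \is monic.
Proof. exact: monic_prod_XsubC. Qed.

Let coefG : G`_m.-1 = - \sum_j x j.
Proof. by apply: coef_pred_prod_XsubC; rewrite card_ord prednK //; lia. Qed.

Let size_subG (P : {poly F}) : size P = m.+1 -> P \is monic -> (size (P - G)%R <= m)%N.
Proof.
move=> sP mP; apply/leq_sizeP => j; rewrite leq_eqVlt => /orP[/eqP<-|mj].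
  rewrite coefB; have /monicP := mP; have /monicP := monicG.
  by rewrite /lead_coef sP sizeG /= => -> ->; rewrite subrr.
by rewrite coefB !nth_default ?subrr // ?sP ?sizeG.
Qed.

(** This numerator is monic of the same degree as [G]; subtracting [G] makes interpolation
    applicable and keeps its values at the nodes. *)
Let Hi i := ('X + h%:P) * Fz (fun k => k != i).

Let Hi_monic i : Hi i \is monic.
Proof.
rewrite monicMl ?monicXaddC //; exact: monic_prod_XsubC.
Qed.

Let size_Hi i : size (Hi i) = m.+1.
Proof.
rewrite size_Mmonic ?monic_neq0 ?monicXaddC //; last exact: monic_prod_XsubC.
rewrite size_XaddC size_prod_XsubC_pred card_neq_ord /=; lia.
Qed.

Let horner_Hi i j : (Hi i - G).[x j] = (x j + h) * \prod_(k | k != i) (x j + (y k + s)).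
Proof. by rewrite !hornerE hornerG hornerFz subr0. Qed.

(** By [lagrange_coef] the sum is the coefficient of degree [m - 1] of [Hi i - G], a difference of
    two sums of roots. *)
Lemma partial_fraction_sum i :
  \sum_j (x j + h) * \prod_(k | k != i) (x j + (y k + s)) / node_weight x j =
  h + \sum_(k | k != i) (y k + s) + \sum_j x j.
Proof.
under eq_bigr do rewrite -horner_Hi.
rewrite lagrange_coef ?size_subG // coefB coefG opprK; congr (_ + _).
rewrite /Hi mulrDl coefD coefXM coefCM.
have := coef_pred_prod_XsubC (P := fun k => k != i) z (n := m.-2).
have := coef_prod_XsubC_pred (fun k => k != i) z.
rewrite -/(Fz _) card_neq_ord => -> -> //; last lia.
rewrite ifF; last lia.
rewrite mulr1 addrC -sumrN; congr (_ + _).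
by apply: eq_bigr => k _; rewrite opprK.
Qed.

(** With two factors left out the numerator is already monic of degree [m - 1], and the sum is its
    leading coefficient. *)
Lemma partial_fraction_offdiag i l : i != l ->
  \sum_j (x j + h) * \prod_(k | (k != i) && (k != l)) (x j + (y k + s)) / node_weight x j = 1.
Proof.
move=> il; pose P := ('X + h%:P) * Fz (fun k => (k != i) && (k != l)).
have cP : #|[pred k | (k != i) && (k != l)]| = m.-2.
  have := cardC1 i; rewrite (cardD1 l) !inE eq_sym il card_ord /= add1n => <-.
  by apply: eq_card => k; rewrite !inE andbC.
have mP : P \is monic by rewrite monicMl ?monicXaddC //; exact: monic_prod_XsubC.
have sP : size P = m.
  rewrite size_Mmonic ?monic_neq0 ?monicXaddC //; last exact: monic_prod_XsubC.
  by rewrite size_XaddC size_prod_XsubC_pred cP /=; lia.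
transitivity P`_m.-1; last by have /monicP := mP; rewrite /lead_coef sP.
rewrite -(lagrange_coef x_inj) ?sP //; apply: eq_bigr => j _.
by rewrite hornerM hornerFz !hornerE.
Qed.

(** This is the interpolation of [Hi i - G] evaluated at [z i], the root omitted from [Hi i]. Up to
    sign, the two terms on the right are the values of [Hi i] and [G] there. *)
Lemma partial_fraction_diag i :
  \sum_j (x j + h) * \prod_(k | k != i) (x j + (y k + s)) / node_weight x j
     * \prod_(k | k != j) (x k + (y i + s)) =
  (h - (y i + s)) * node_weight y i + \prod_k (x k + (y i + s)).
Proof.
have := @lagrange_horner F m x x_inj (Hi i - G) (z i) (size_subG (size_Hi i) (Hi_monic i)).
under [X in _ = X]eq_bigr => j _.
  have -> : \prod_(k < m | k != j) (z i - x k) =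
      (-1) ^+ m.-1 * \prod_(k < m | k != j) (x k + (y i + s)).
    rewrite -(card_neq_ord j) -prodrN; apply: eq_bigr => k _; rewrite /z; ring.
  rewrite mulrCA horner_Hi; over.
have signV e f : e = (-1) ^+ m.-1 * f -> f = (-1) ^+ m.-1 * e :> F.
  by move=> ->; rewrite signrMK.
rewrite -mulr_sumr => /signV ->.
rewrite !hornerE hornerFz mulrBr mulrCA; congr (_ + _).
  rewrite /z [- _ + h]addrC; congr (_ * _).
  rewrite -(card_neq_ord i) -prodrN; apply: eq_bigr => k _; ring.
(* [G] has one factor more than the node products, so its sign is opposite and the subtraction
   becomes an addition. *)
have -> : (-1) ^+ m.-1 = - (-1) ^+ m :> F.
  by rewrite -[in RHS](prednK (ltnW m_gt1)) exprS mulN1r opprK.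
rewrite mulNr opprK horner_prod.
have -> : \prod_(k < m) ('X - (x k)%:P).[z i] = (-1) ^+ m * \prod_k (x k + (y i + s)).
  rewrite -[in (-1) ^+ m](card_ord m) -prodrN; apply: eq_bigr => k _; rewrite hornerXsubC /z; ring.
by rewrite signrMK.
Qed.

End PartialFractions.

Section TotalSum.
Variables (F : fieldType) (m : nat).
Hypothesis m_gt1 : (1 < m)%N.

Let G (x : 'I_m -> F) : {poly F} := \prod_j ('X - (x j)%:P).

(** Here the numerator has degree [m + 1], so it is reduced modulo [G x] before its coefficient is
    read. The coefficient of degree [m - 2] is left unevaluated, since it cancels in
    [partial_fraction_total]. *)
Lemma lagrange_quotient_sum (x z : 'I_m -> F) (h : F) : injective x ->
  let D := \sum_j x j - \sum_j z j in
  \sum_j (x j + h) * \prod_k (x j - z k) / node_weight x j =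
  (G z - G x)`_m.-2 + h * D + D * \sum_j x j.
Proof.
move=> x_inj D.
have sG y : size (G y) = m.+1 by rewrite size_prod_XsubC_pred card_ord.
have cG y : (G y)`_m = 1 by rewrite -[in X in _`_X](card_ord m) coef_prod_XsubC_pred.
have cG1 y : (G y)`_m.-1 = - \sum_j y j.
  by apply: coef_pred_prod_XsubC; rewrite card_ord prednK //; lia.
have cD : (G z - G x)`_m.-1 = D by rewrite coefB !cG1 opprK addrC.
have sD : (size (G z - G x)%R <= m)%N.
  apply/leq_sizeP => j; rewrite leq_eqVlt coefB => /orP[/eqP<-|mj].
    by rewrite !cG subrr.
  by rewrite !nth_default ?subrr ?sG.
(* At the nodes [G x] vanishes, so the values are those of [('X + h%:P) * G z]; the multiple [D]
   cancels the term of degree [m]. *)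
pose P := ('X + h%:P) * (G z - G x) - D *: G x.
have PE : P = 'X * (G z - G x) + h%:P * (G z - G x) - D *: G x by rewrite /P mulrDl.
have sP : (size P <= m)%N.
  apply/leq_sizeP => j mj; rewrite PE coefB coefD coefXM coefCM coefZ.
  rewrite [(G z - G x)`_j](leq_sizeP _ _ sD) // mulr0 addr0 ifF; last lia.
  move: mj; rewrite leq_eqVlt => /orP[/eqP<-|mj]; first by rewrite cD cG mulr1 subrr.
  by rewrite (leq_sizeP _ _ sD) ?nth_default ?mulr0 ?subr0 ?sG //; lia.
have GE y a : (G y).[a] = \prod_k (a - y k).
  by rewrite horner_prod; apply: eq_bigr => k _; rewrite hornerXsubC.
have Gx j : (G x).[x j] = 0 by rewrite GE (bigD1 j) //= subrr mul0r.
transitivity P`_m.-1.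
  rewrite -(lagrange_coef x_inj sP); apply: eq_bigr => j _.
  by rewrite !hornerE Gx GE mulr0 !subr0.
rewrite PE [LHS]coefB [X in X - _]coefD coefXM coefCM coefZ cD cG1 ifF; last lia.
by rewrite mulrN opprK.
Qed.

(** With [z i = - (y i + s)], the second sum is the first with [x] and [z] exchanged and [h]
    replaced by [s - h']. This changes the sign of [D] and of the unevaluated coefficient. *)
Lemma partial_fraction_total (x y : 'I_m -> F) (s h h' : F) :
  injective x -> injective y ->
  let D := \sum_j x j + \sum_i (y i + s) in
  \sum_j (x j + h) * \prod_k (x j + (y k + s)) / node_weight x j +
  \sum_i (y i + h') * \prod_k (x k + (y i + s)) / node_weight y i =
  D * (D + h + h' - s).
Proof.
move=> x_inj y_inj D; pose z i := - (y i + s).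
have z_inj : injective z by move=> i k /oppr_inj /addIr /y_inj.
have zE : \sum_i (y i + s) = - \sum_i z i.
  by rewrite -sumrN; apply: eq_bigr => i _; rewrite opprK.
have -> : \sum_j (x j + h) * \prod_k (x j + (y k + s)) / node_weight x j =
          \sum_j (x j + h) * \prod_k (x j - z k) / node_weight x j.
  by apply: eq_bigr => j _; congr (_ * _ / _); apply: eq_bigr => k _; rewrite opprK.
have -> : \sum_i (y i + h') * \prod_k (x k + (y i + s)) / node_weight y i =
          \sum_i (z i + (s - h')) * \prod_k (z i - x k) / node_weight z i.
  apply: eq_bigr => i _.
  have -> : \prod_k (z i - x k) = (-1) ^+ m * \prod_k (x k + (y i + s)).
    rewrite -[in (-1) ^+ m](card_ord m) -prodrN; apply: eq_bigr => k _; rewrite /z; ring.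
  have -> : node_weight z i = (-1) ^+ m.-1 * node_weight y i.
    rewrite -(card_neq_ord i) -prodrN; apply: eq_bigr => k _; rewrite /z; ring.
  have -> : z i + (s - h') = - (y i + h') by rewrite /z; ring.
  have -> : (-1) ^+ m = - (-1) ^+ m.-1 :> F by rewrite -[in LHS](prednK (ltnW m_gt1)) exprS mulN1r.
  rewrite invfM invr_sign; set e := (-1) ^+ m.-1.
  transitivity (e ^+ 2 * ((y i + h') * \prod_k (x k + (y i + s)) / node_weight y i)).
    by rewrite sqrr_sign mul1r.
  ring.
rewrite !lagrange_quotient_sum // !coefB /D zE; ring.
Qed.
End TotalSum.

(** * Entries of the square of a bordered Cauchy-like matrix *)

Section BlockEntries.
Variables (F : fieldType) (m : nat).
Implicit Types (S : 'I_m -> 'I_m -> bool) (Q : 'I_m -> 'I_m -> F) (u v : 'I_m -> F).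

Definition border u S Q i : F := u i * sel S Q i.
(** By [sel_off_corner], multiplying by [Q i j] gives minus the product of two borders. Omitting
    that factor from both products, rather than dividing, keeps the entry right when [Q i j = 0]. *)
Definition block u v S N Q i j : F :=
  - (u i * v j) * (selx S Q i j * selx (fun j i => N i j) (fun j i => Q i j) j i).

End BlockEntries.

Section QuadraticEntries.
Variables (F : fieldType) (m : nat) (x y : 'I_m -> F) (a1 a2 b2 b3 : F).
Variables (S N : 'I_m -> 'I_m -> bool) (Q : 'I_m -> 'I_m -> F) (u v u' v' : 'I_m -> F).
Hypotheses (m_gt1 : (1 < m)%N) (x_inj : injective x) (y_inj : injective y).
Let s := b2 + b3 - a1 - a2.
Hypothesis NS : forall i j, N i j = ~~ S i j.
Hypothesis QE : forall i j, Q i j = x j + (y i + s).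
Hypothesis uvE : forall i, u i * v i = - (y i + b2 - a1) / node_weight y i.
Hypothesis uv'E : forall j, u' j * v' j = - (x j + b3 - a1) / node_weight x j.

Let St j i := S i j.
Let Nt j i := N i j.
Let Qt j i := Q i j.
(** The value that the trace condition forces on the corner [b1 + c (2m+1)]; see [tE]. *)
Let t := a1 - \sum_j x j - \sum_i (y i + s).

Let blockE i j :
  block u v' S N Q i j = - (u i * v' j) * (selx S Q i j * selx Nt Qt j i).
Proof. by []. Qed.

Let blocktE i j :
  block u' v St Nt Qt j i = - (u' j * v i) * (selx St Qt j i * selx N Q i j).
Proof. by []. Qed.

Let sum_weight i :
  \sum_j u' j * v' j * \prod_(k | k != i) Q k j =
  - (b3 - a1 + \sum_(k | k != i) (y k + s) + \sum_j x j).
Proof.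
rewrite -(partial_fraction_sum y s (b3 - a1) x_inj m_gt1 i) -sumrN.
apply: eq_bigr => j _; rewrite uv'E.
under eq_bigr do rewrite QE.
ring.
Qed.

(** By [sel_row] the border entry factors out of the sum. The remaining scalar is [a1 + a2], since
    [t] cancels the sums over [x] and over the other [y k]. *)
Lemma row_entry i :
  t * border v N Q i + border v N Q i * (b2 + y i) +
  \sum_j border v' Nt Qt j * block u' v St Nt Qt j i = (a1 + a2) * border v N Q i.
Proof.
have -> : \sum_j border v' Nt Qt j * block u' v St Nt Qt j i =
  - border v N Q i * \sum_j u' j * v' j * \prod_(k | k != i) Q k j.
  rewrite mulr_sumr; apply: eq_bigr => j _; rewrite ?blockE ?blocktE /border.
  have := sel_row Q NS i j; rewrite -/St -/Nt -/Qt => E.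
  transitivity (- (u' j * v' j * v i) * (sel Nt Qt j * (selx St Qt j i * selx N Q i j))).
    by ring.
  by rewrite E; ring.
rewrite sum_weight /t [\sum_i (y i + s)](bigD1 i) //= /s; ring.
Qed.

Lemma col_entry i :
  border u S Q i * t + (b2 + y i) * border u S Q i +
  \sum_j block u v' S N Q i j * border u' St Qt j = (a1 + a2) * border u S Q i.
Proof.
have -> : \sum_j block u v' S N Q i j * border u' St Qt j =
  - border u S Q i * \sum_j u' j * v' j * \prod_(k | k != i) Q k j.
  rewrite mulr_sumr; apply: eq_bigr => j _; rewrite ?blockE ?blocktE /border.
  (* Complementation is symmetric, so [sel_row] also applies with [S] and [N] exchanged. *)
  have SN k l : S k l = ~~ N k l by rewrite NS negbK.
  have := sel_row Q SN i j; rewrite -/St -/Nt -/Qt => E.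
  transitivity (- (u' j * v' j * u i) * (sel St Qt j * (selx Nt Qt j i * selx S Q i j))).
    by ring.
  by rewrite E; ring.
rewrite sum_weight /t [\sum_i (y i + s)](bigD1 i) //= /s; ring.
Qed.

(** After [sel_offdiag] the sum is minus the product of the borders times a partial fraction sum
    equal to 1. *)
Lemma offdiag_entry i l : i != l ->
  border u S Q i * border v N Q l +
  \sum_j block u v' S N Q i j * block u' v St Nt Qt j l = 0.
Proof.
move=> il.
have -> : \sum_j block u v' S N Q i j * block u' v St Nt Qt j l =
  - (border u S Q i * border v N Q l) *
  \sum_j (x j + (b3 - a1)) * \prod_(k | (k != i) && (k != l)) (x j + (y k + s)) / node_weight x j.
  rewrite mulr_sumr; apply: eq_bigr => j _; rewrite ?blockE ?blocktE /border.
  have := sel_offdiag Q NS j il; rewrite -/St -/Nt -/Qt => E.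
  transitivity ((u' j * v' j) * (u i * v l) *
    (selx S Q i j * selx Nt Qt j i * (selx St Qt j l * selx N Q l j))).
    by ring.
  rewrite E uv'E.
  under [X in _ = _ * (_ * X / _)]eq_bigr do rewrite -QE.
  ring.
rewrite partial_fraction_offdiag //; ring.
Qed.

(** The product term of [partial_fraction_diag] cancels the borders. With [w = b2 + y i], there
    remains [w^2 - (w - a1) (w - a2)]. *)
Lemma diag_entry i :
  border u S Q i * border v N Q i + (b2 + y i) * (b2 + y i) +
  \sum_j block u v' S N Q i j * block u' v St Nt Qt j i =
  (a1 + a2) * (b2 + y i) - a1 * a2.
Proof.
have -> : \sum_j block u v' S N Q i j * block u' v St Nt Qt j i =
  - (u i * v i) *
  \sum_j (x j + (b3 - a1)) * \prod_(k | k != i) (x j + (y k + s)) / node_weight x j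
     * \prod_(k | k != j) (x k + (y i + s)).
  rewrite mulr_sumr; apply: eq_bigr => j _; rewrite ?blockE ?blocktE /border.
  have := sel_diag Q NS i j; rewrite -/St -/Nt -/Qt => E.
  transitivity ((u' j * v' j) * (u i * v i) *
    (selx S Q i j * selx Nt Qt j i * (selx St Qt j i * selx N Q i j))).
    by ring.
  rewrite E uv'E.
  under [X in _ = _ * (_ * X / _ * _)]eq_bigr do rewrite -QE.
  under [X in _ = _ * (_ * X)]eq_bigr do rewrite -QE.
  ring.
rewrite partial_fraction_diag //.
have -> : border u S Q i * border v N Q i = u i * v i * \prod_k (x k + (y i + s)).
  rewrite /border mulrACA; congr (_ * _).
  rewrite [RHS](bigID (S i)) /=; congr (_ * _).
    by apply: eq_bigr => k _; rewrite QE.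
  by apply: eq_big => k; rewrite ?NS // QE.
rewrite uvE /s.
have nw := node_weight_neq0 y_inj i.
by field.
Qed.

(** No sum occurs: the borders give [- Q i j] times the block, and [(b2 + y i) + (b3 + x j) - Q i j
    = a1 + a2]. *)
Lemma corner_entry i j :
  border u S Q i * border v' Nt Qt j + (b2 + y i) * block u v' S N Q i j +
  block u v' S N Q i j * (b3 + x j) = (a1 + a2) * block u v' S N Q i j.
Proof.
rewrite /border mulrACA (sel_off_corner Q NS i j) blockE QE /s; ring.
Qed.

(** With [D = a1 - t], the two border sums add up to [- (a1 - t) (a2 - t)]. *)
Lemma total_entry :
  t * t + \sum_i border v N Q i * border u S Q i +
  \sum_j border v' Nt Qt j * border u' St Qt j = (a1 + a2) * t - a1 * a2.
Proof.
have -> : \sum_i border v N Q i * border u S Q i =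
  - \sum_i (y i + (b2 - a1)) * \prod_k (x k + (y i + s)) / node_weight y i.
  rewrite -sumrN; apply: eq_bigr => i _.
  rewrite /border mulrACA [v i * _]mulrC uvE.
  have -> : sel N Q i * sel S Q i = \prod_k (x k + (y i + s)).
    rewrite mulrC [RHS](bigID (S i)) /=; congr (_ * _).
      by apply: eq_bigr => k _; rewrite QE.
    by apply: eq_big => k; rewrite ?NS // QE.
  ring.
have -> : \sum_j border v' Nt Qt j * border u' St Qt j =
  - \sum_j (x j + (b3 - a1)) * \prod_k (x j + (y k + s)) / node_weight x j.
  rewrite -sumrN; apply: eq_bigr => j _.
  rewrite /border mulrACA [v' j * _]mulrC uv'E.
  have -> : sel Nt Qt j * sel St Qt j = \prod_k (x j + (y k + s)).
    rewrite mulrC [RHS](bigID (S^~ j)) /=; congr (_ * _).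
      by apply: eq_bigr => k _; rewrite /Qt QE.
    by apply: eq_big => k; rewrite /Nt ?NS // /Qt QE.
  ring.
have := partial_fraction_total m_gt1 s (b3 - a1) (b2 - a1) x_inj y_inj.
rewrite /t /=; set X := \sum_j _ / _; set Y := \sum_i _ / _ => E.
have -> : forall T, T - Y - X = T - (X + Y) by move=> T; ring.
rewrite E /s; ring.
Qed.
End QuadraticEntries.

(** * Reindexing of the ranges and splitting of the residues *)

(** Substitutes [k = n - j]; used with [n = m] for the nodes [x] and [n = 2m] for the nodes [y]. *)
Lemma big_nat_rev_ord (T : Type) (idx : T) (op : Monoid.com_law idx) n m lo hi
    (P : pred nat) (f : nat -> T) :
  (m <= n)%N -> (n - m < lo)%N -> (hi <= n.+1)%N ->
  \big[op/idx]_(lo <= k < hi | P k) f k =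
  \big[op/idx]_(j < m | (lo <= n - j < hi)%N && P (n - j)%N) f (n - j)%N.
Proof.
move=> mn nlo hin.
rewrite (big_nat_widenl _ (n - m).+1) // (big_nat_widen _ _ n.+1) //.
rewrite big_nat_rev -{1}[(n - m).+1]add0n big_addn subSS subKn // big_mkord.
apply: eq_big => j; last by move=> _; congr f; lia.
have jm := ltn_ord j; rewrite (_ : (_ - _)%N = n - j)%N; last lia.
by rewrite -andbA andbC.
Qed.

Lemma sum_ord_split (V : nmodType) m (f : nat -> V) :
  \sum_(k < 2 * m + 1) f k =
  f 0%N + \sum_(i < m) f i.+1 + \sum_(i < m) f (m + i).+1.
Proof.
rewrite -(big_mkord xpredT f) addn1 big_nat_recl // -addrA; congr (_ + _).
rewrite (big_cat_nat (n := m)) //=; last lia.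
rewrite big_mkord; congr (_ + _).
rewrite -{1}[m]add0n big_addn (_ : 2 * m - m = m)%N; last lia.
by rewrite big_mkord; apply: eq_bigr => i _; rewrite addnC.
Qed.

Section Factors.
Variables (F : fieldType) (m : nat) (a b : F) (y : 'I_m -> F).
(** The residue at node [i] is split by index order: earlier nodes go to [lower_factor], later ones
    and the numerator to [upper_factor]. *)
Definition lower_factor (i : 'I_m) : F := - (\prod_(k < m | (k < i)%N) (y i - y k))^-1.
Definition upper_factor (i : 'I_m) : F :=
  (-1) ^+ (m - i.+1) * (y i + b - a) / \prod_(k < m | (i < k)%N) (y k - y i).

Lemma lower_mul_upper i :
  lower_factor i * upper_factor i = - (y i + b - a) / node_weight y i.
Proof.
have -> : node_weight y i =
    (-1) ^+ (m - i.+1) * \prod_(k < m | (i < k)%N) (y k - y i) *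
    \prod_(k < m | (k < i)%N) (y i - y k).
  rewrite /node_weight (bigID (fun k : 'I_m => (i < k)%N)) /=; congr (_ * _).
    (* The sign in [upper_factor] reverses one difference for each of the [m - i - 1] later
       nodes. *)
    have <- : #|[pred k : 'I_m | (i < k)%N]| = (m - i.+1)%N.
      rewrite -sum1_card -(big_mkord (fun k => i < k)%N (fun=> 1%N)).
      by rewrite -(big_nat_widenl i.+1 0 m predT) // sum_nat_const_nat muln1.
    rewrite -prodrN; apply: eq_big => k; last by rewrite opprB.
    by rewrite -val_eqE /= inE; lia.
  by apply: eq_bigl => k; rewrite -val_eqE /=; lia.
by rewrite /lower_factor /upper_factor !invfM invr_sign; ring.
Qed.
End Factors.

(** * The matrices of the odd family in block form *)

Section OddFamilyBlocks.
Variables (F : fieldType) (m : nat) (a1 a2 b1 b2 b3 : F) (c : nat -> F).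

Let x (j : 'I_m) := c (m - j)%N.
Let y (i : 'I_m) := c (2 * m - i)%N.
(** With zero-based [i] and [j], the numerator of [C1a] contains [q_(m-j, 2m-i)] exactly when
    [m - j <= i + 1]. *)
Let S (i j : 'I_m) := (m <= i + j + 1)%N.
Let N (i j : 'I_m) := ~~ S i j.
Let Q (i j : 'I_m) := qq a1 a2 b2 b3 c (m - j)%N (2 * m - i)%N.
Let St (j i : 'I_m) := S i j.
Let Nt (j i : 'I_m) := N i j.
Let Qt (j i : 'I_m) := Q i j.
Let u := lower_factor y.
Let v := upper_factor a1 b2 y.
Let u' := lower_factor x.
Let v' := upper_factor a1 b3 x.

Let idxy (i : 'I_m) : (2 * m + 1 - i.+1 = 2 * m - i)%N. Proof. lia. Qed.
Let idxx (i : 'I_m) : (m + 1 - i.+1 = m - i)%N. Proof. lia. Qed.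

Let prodx lo hi (P : pred nat) f : (0 < lo)%N -> (hi <= m.+1)%N ->
  \prod_(lo <= k < hi | P k) f k =
  \prod_(j < m | (lo <= m - j < hi)%N && P (m - j)%N) f (m - j)%N :> F.
Proof. by move=> lo0 him; apply: big_nat_rev_ord => //; lia. Qed.

Let prody lo hi (P : pred nat) f : (m < lo)%N -> (hi <= (2 * m).+1)%N ->
  \prod_(lo <= k < hi | P k) f k =
  \prod_(j < m | (lo <= 2 * m - j < hi)%N && P (2 * m - j)%N) f (2 * m - j)%N :> F.
Proof. by move=> lo0 him; apply: big_nat_rev_ord => //; lia. Qed.

(** After reindexing only index conditions remain to be compared: the order of indices in the
    denominator, the staircase in the numerator. The next five lemmas follow the same pattern. *)
Lemma B1aE (i : 'I_m) : B1a m a1 a2 b2 b3 c i.+1 = border v N Q i.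
Proof.
have im := ltn_ord i; rewrite /B1a /border /v /upper_factor /sel idxy prodx; [|lia..].
rewrite prody; [|lia..].
rewrite mulrAC; congr (_ * _ * _^-1 * _); apply: eq_bigl => j; have jm := ltn_ord j.
  by rewrite andbT; lia.
by rewrite andbT /N /S; lia.
Qed.

Lemma B1bE (j : 'I_m) : B1b m a1 a2 b2 b3 c j.+1 = border v' Nt Qt j.
Proof.
have jm := ltn_ord j; rewrite /B1b /border /v' /upper_factor /sel idxx prody; [|lia..].
rewrite prodx; [|lia..].
rewrite mulrAC; congr (_ * _ * _^-1 * _); apply: eq_bigl => i; have im := ltn_ord i.
  by rewrite andbT; lia.
by rewrite andbT /Nt /N /S; lia.
Qed.

Lemma C1aE (i : 'I_m) : C1a m a1 a2 b2 b3 c i.+1 = border u S Q i.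
Proof.
have im := ltn_ord i; rewrite /C1a /border /u /lower_factor /sel idxy prodx; [|lia..].
rewrite prody; [|lia..].
rewrite [LHS]mulrC mulrN -mulNr.
congr (- _^-1 * _); apply: eq_bigl => j; have jm := ltn_ord j.
  by rewrite andbT; lia.
by rewrite andbT /S; lia.
Qed.

Lemma C1bE (j : 'I_m) : C1b m a1 a2 b2 b3 c j.+1 = border u' St Qt j.
Proof.
have jm := ltn_ord j; rewrite /C1b /border /u' /lower_factor /sel idxx prody; [|lia..].
rewrite prodx; [|lia..].
rewrite [LHS]mulrC mulrN -mulNr.
congr (- _^-1 * _); apply: eq_bigl => i; have im := ltn_ord i.
  by rewrite andbT; lia.
by rewrite andbT /St /S; lia.
Qed.

Lemma BijE (i j : 'I_m) : Bij m a1 a2 b2 b3 c i.+1 j.+1 = block u v' S N Q i j.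
Proof.
have im := ltn_ord i; have jm := ltn_ord j.
rewrite /Bij /block /u /v' /lower_factor /upper_factor /selx idxy idxx.
rewrite prodx; [|lia..]; rewrite prody; [|lia..]; rewrite prody; [|lia..].
rewrite prodx; [|lia..].
rewrite [X in - X * _]mulNr opprK invfM.
have -> (e p q r d f : F) : e * p * (q * r) * (d * f) = d * (e * p * f) * (q * r) by ring.
congr (_^-1 * (_ * _^-1) * (_ * _)); apply: eq_bigl => k; have km := ltn_ord k.
- by rewrite andbT; lia.
- by rewrite andbT; lia.
- by rewrite -val_eqE /= /S; lia.
- by rewrite -val_eqE /= /N /S; lia.
Qed.

Lemma CijE (i j : 'I_m) : Cij m a1 a2 b2 b3 c j.+1 i.+1 = block u' v St Nt Qt j i.
Proof.
have im := ltn_ord i; have jm := ltn_ord j.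
rewrite /Cij /block /u' /v /lower_factor /upper_factor /selx idxy idxx.
rewrite prody; [|lia..]; rewrite prodx; [|lia..]; rewrite prodx; [|lia..].
rewrite prody; [|lia..].
rewrite [X in - X * _]mulNr opprK invfM.
have -> (e p q r d f : F) : e * p * (q * r) * (d * f) = d * (e * p * f) * (q * r) by ring.
congr (_^-1 * (_ * _^-1) * (_ * _)); apply: eq_bigl => k; have km := ltn_ord k.
- by rewrite andbT; lia.
- by rewrite andbT; lia.
- by rewrite -val_eqE /= /St /S; lia.
- by rewrite -val_eqE /= /Nt /N /S; lia.
Qed.

Let A (r s : nat) : F := Bnat m a1 a2 b1 b2 b3 c r.+1 s.+1 + Cnat m a1 a2 b2 b3 c r.+1 s.+1.

Ltac resolve_ifs := repeat (case: ifP => ?; try by exfalso; lia).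

Let A00 : A 0 0 = b1 + c (2 * m + 1)%N. Proof. by []. Qed.

Let A01 (i : 'I_m) : A 0 i.+1 = border v N Q i.
Proof.
have im := ltn_ord i; rewrite -B1aE /A /Bnat /Cnat; resolve_ifs.
by rewrite addr0; congr B1a; lia.
Qed.

Let A02 (j : 'I_m) : A 0 (m + j).+1 = border v' Nt Qt j.
Proof.
have jm := ltn_ord j; rewrite -B1bE /A /Bnat /Cnat; resolve_ifs.
by rewrite addr0; congr B1b; lia.
Qed.

Let A10 (i : 'I_m) : A i.+1 0 = border u S Q i.
Proof.
have im := ltn_ord i; rewrite -C1aE /A /Bnat /Cnat; resolve_ifs.
by rewrite add0r; congr C1a; lia.
Qed.

Let A20 (j : 'I_m) : A (m + j).+1 0 = border u' St Qt j.
Proof.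
have jm := ltn_ord j; rewrite -C1bE /A /Bnat /Cnat; resolve_ifs.
by rewrite add0r; congr C1b; lia.
Qed.

Let A12 (i j : 'I_m) : A i.+1 (m + j).+1 = block u v' S N Q i j.
Proof.
have im := ltn_ord i; have jm := ltn_ord j; rewrite -BijE /A /Bnat /Cnat; resolve_ifs.
by rewrite addr0; congr Bij; lia.
Qed.

Let A21 (i j : 'I_m) : A (m + j).+1 i.+1 = block u' v St Nt Qt j i.
Proof.
have im := ltn_ord i; have jm := ltn_ord j; rewrite -CijE /A /Bnat /Cnat; resolve_ifs.
by rewrite add0r; congr Cij; lia.
Qed.

Let A11 (i k : 'I_m) : A i.+1 k.+1 = (b2 + y i) *+ (i == k).
Proof.
have im := ltn_ord i; have km := ltn_ord k; rewrite /A /Bnat /Cnat.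
case: (altP (i =P k)) => [<-|]; last by rewrite -val_eqE /= => ?; resolve_ifs; rewrite addr0.
resolve_ifs.
by rewrite mulr1n /y; congr (_ + c _); lia.
Qed.

Let A22 (j k : 'I_m) : A (m + j).+1 (m + k).+1 = (b3 + x j) *+ (j == k).
Proof.
have jm := ltn_ord j; have km := ltn_ord k; rewrite /A /Bnat /Cnat.
case: (altP (j =P k)) => [<-|]; last by rewrite -val_eqE /= => ?; resolve_ifs; rewrite addr0.
resolve_ifs.
by rewrite mulr1n /x; congr (_ + c _); lia.
Qed.

(** * Assembly of the quadratic relation and of the trace *)

Hypothesis m_gt1 : (1 < m)%N.
Hypothesis c_inj : forall i j : nat, (1 <= i <= 2 * m + 1)%N -> (1 <= j <= 2 * m + 1)%N ->
  i != j -> c i != c j.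
Hypothesis trace_eq : (m + 1)%:R * a1 + m%:R * a2 =
  b1 + m%:R * b2 + m%:R * b3 + \sum_(1 <= i < 2 * m + 2) c i.

Let x_inj : injective x.
Proof.
move=> i j xij; apply/eqP/negPn/negP => ij.
have := ltn_ord i; have := ltn_ord j => jm im.
suff: c (m - i)%N != c (m - j)%N by move=> /eqP; apply.
by apply: c_inj; move: ij; rewrite -val_eqE /=; lia.
Qed.

Let y_inj : injective y.
Proof.
move=> i j xij; apply/eqP/negPn/negP => ij.
have := ltn_ord i; have := ltn_ord j => jm im.
suff: c (2 * m - i)%N != c (2 * m - j)%N by move=> /eqP; apply.
by apply: c_inj; move: ij; rewrite -val_eqE /=; lia.
Qed.

Let sum_c : \sum_(1 <= i < 2 * m + 2) c i = \sum_j x j + \sum_i y i + c (2 * m + 1)%N.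
Proof.
rewrite (_ : 2 * m + 2 = (2 * m + 1).+1)%N; last lia.
rewrite big_nat_recr /=; last lia.
congr (_ + _); rewrite (big_cat_nat (n := m.+1)) //=; last lia.
rewrite (@big_nat_rev_ord _ _ _ m m) //; last lia.
rewrite (@big_nat_rev_ord _ _ _ (2 * m) m) //; [|lia..].
congr (_ + _); apply: eq_bigl => j; have jm := ltn_ord j; rewrite andbT; lia.
Qed.

Let s := b2 + b3 - a1 - a2.
Let t := b1 + c (2 * m + 1)%N.

Let tE : t = a1 - \sum_j x j - \sum_i (y i + s).
Proof.
rewrite big_split /= sumr_const card_ord -mulr_natl /s /t.
set X := \sum_j x j; set Y := \sum_i y i.
(* Completes [b1] to the right-hand side of [trace_eq], so that it can be rewritten. *)
have -> : b1 = b1 + m%:R * b2 + m%:R * b3 + (X + Y + c (2 * m + 1)%N)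
  - (m%:R * b2 + m%:R * b3 + (X + Y + c (2 * m + 1)%N)) by ring.
rewrite -sum_c -trace_eq sum_c natrD -/X -/Y; ring.
Qed.

Let NS i j : N i j = ~~ S i j. Proof. by []. Qed.
Let NSt j i : Nt j i = ~~ St j i. Proof. by []. Qed.
Let QE i j : Q i j = x j + (y i + s). Proof. by rewrite /Q /qq /s /x /y; ring. Qed.
(** Exchanging [x] with [y] and [b2] with [b3], and transposing [S], [N], [Q], preserves the
    hypotheses of the entry lemmas. This form of [s] lets them serve the other half of the
    matrix. *)
Let s' := b3 + b2 - a1 - a2.
Let QtE j i : Qt j i = y i + (x j + s').
Proof. by rewrite /Qt /Q /qq /s' /x /y; ring. Qed.
Let uvE i : u i * v i = - (y i + b2 - a1) / node_weight y i.
Proof. exact: lower_mul_upper. Qed.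
Let uvE' j : u' j * v' j = - (x j + b3 - a1) / node_weight x j.
Proof. exact: lower_mul_upper. Qed.
Let tE' : t = a1 - \sum_i y i - \sum_j (x j + s').
Proof.
have E (z : 'I_m -> F) : \sum_j (z j + s) = \sum_j z j + m%:R * s.
  by rewrite big_split /= sumr_const card_ord mulr_natl.
rewrite tE (_ : s' = s) ?E; last by rewrite /s' /s; ring.
by rewrite !opprD !addrA [a1 - _ - _]addrAC.
Qed.

Let total : t * t + \sum_i border v N Q i * border u S Q i +
  \sum_j border v' Nt Qt j * border u' St Qt j = (a1 + a2) * t - a1 * a2.
Proof. by rewrite tE; apply: total_entry. Qed.

Let row1 i : t * border v N Q i + border v N Q i * (b2 + y i) +
  \sum_j border v' Nt Qt j * block u' v St Nt Qt j i = (a1 + a2) * border v N Q i.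
Proof. by rewrite tE; apply: row_entry. Qed.

Let row2 j : t * border v' Nt Qt j + border v' Nt Qt j * (b3 + x j) +
  \sum_i border v N Q i * block u v' S N Q i j = (a1 + a2) * border v' Nt Qt j.
Proof.
by rewrite tE'; apply: (@row_entry _ _ y x a1 a2 b3 b2 St Nt Qt v' u v).
Qed.

Let col1 i : border u S Q i * t + (b2 + y i) * border u S Q i +
  \sum_j block u v' S N Q i j * border u' St Qt j = (a1 + a2) * border u S Q i.
Proof. by rewrite tE; apply: col_entry. Qed.

Let col2 j : border u' St Qt j * t + (b3 + x j) * border u' St Qt j +
  \sum_i block u' v St Nt Qt j i * border u S Q i = (a1 + a2) * border u' St Qt j.
Proof.
by rewrite tE'; apply: (@col_entry _ _ y x a1 a2 b3 b2 St Nt Qt u' u v).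
Qed.

Let off1 i l : i != l -> border u S Q i * border v N Q l +
  \sum_j block u v' S N Q i j * block u' v St Nt Qt j l = 0.
Proof. by apply: (@offdiag_entry _ _ x y a1 a2 b2 b3 S N Q u v u' v'). Qed.

Let off2 j l : j != l -> border u' St Qt j * border v' Nt Qt l +
  \sum_i block u' v St Nt Qt j i * block u v' S N Q i l = 0.
Proof. by apply: (@offdiag_entry _ _ y x a1 a2 b3 b2 St Nt Qt u' v' u v). Qed.

Let diag1 i : border u S Q i * border v N Q i + (b2 + y i) * (b2 + y i) +
  \sum_j block u v' S N Q i j * block u' v St Nt Qt j i =
  (a1 + a2) * (b2 + y i) - a1 * a2.
Proof. exact: (@diag_entry _ _ x y a1 a2 b2 b3 S N Q u v u' v'). Qed.

Let diag2 j : border u' St Qt j * border v' Nt Qt j + (b3 + x j) * (b3 + x j) +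
  \sum_i block u' v St Nt Qt j i * block u v' S N Q i j =
  (a1 + a2) * (b3 + x j) - a1 * a2.
Proof. exact: (@diag_entry _ _ y x a1 a2 b3 b2 St Nt Qt u' v' u v). Qed.

Let corner1 i j : border u S Q i * border v' Nt Qt j + (b2 + y i) * block u v' S N Q i j +
  block u v' S N Q i j * (b3 + x j) = (a1 + a2) * block u v' S N Q i j.
Proof. exact: (@corner_entry _ _ x y a1 a2 b2 b3 S N Q u v'). Qed.

Let corner2 i j : border u' St Qt j * border v N Q i +
  (b3 + x j) * block u' v St Nt Qt j i + block u' v St Nt Qt j i * (b2 + y i) =
  (a1 + a2) * block u' v St Nt Qt j i.
Proof. exact: (@corner_entry _ _ y x a1 a2 b3 b2 St Nt Qt u' v). Qed.

Let sum_mulr_delta (f d : 'I_m -> F) i : \sum_k f k * (d k *+ (k == i)) = f i * d i.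
Proof.
rewrite (bigD1 i) //= eqxx mulr1n big1 ?addr0 // => k /negbTE ->.
by rewrite mulr0n mulr0.
Qed.

Let sum_mull_delta (f : 'I_m -> F) d i : \sum_k d *+ (i == k) * f k = d * f i.
Proof.
rewrite (bigD1 i) //= eqxx mulr1n big1 ?addr0 // => k; rewrite eq_sym => /negbTE ->.
by rewrite mulr0n mul0r.
Qed.

Let ord_cases r : (r < 2 * m + 1)%N ->
  [\/ r = 0%N, exists i : 'I_m, r = i.+1 | exists j : 'I_m, r = (m + j).+1].
Proof.
case: r => [|r] rm; first by constructor 1.
have [rm'|rm'] := ltnP r m; first by constructor 2; exists (Ordinal rm').
have rm2 : (r - m < m)%N by lia.
by constructor 3; exists (Ordinal rm2) => /=; rewrite subnKC.
Qed.

Let A_square r q : (r < 2 * m + 1)%N -> (q < 2 * m + 1)%N ->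
  \sum_(k < 2 * m + 1) A r k * A k q = (a1 + a2) * A r q - a1 * a2 *+ (r == q).
Proof.
move=> rm qm; rewrite (sum_ord_split _ (fun k => A r k * A k q)).
have noteq (i j : 'I_m) : (i.+1 == (m + j).+1) = false by have := ltn_ord i; lia.
have eqm (i j : 'I_m) : ((m + i).+1 == (m + j).+1) = (i == j).
  by rewrite eqSS eqn_add2l.
(* Nine cases: row, then column, in the corner, the [y] block or the [x] block. *)
case/ord_cases: rm => [->|[i ->]|[j ->]]; case/ord_cases: qm => [->|[k ->]|[k ->]].
- under eq_bigr do rewrite A01 A10.
  under [X in _ + X]eq_bigr do rewrite A02 A20.
  by rewrite A00 total mulr1n.
- under eq_bigr do rewrite A01 A11.
  under [X in _ + X]eq_bigr do rewrite A02 A21.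
  by rewrite A00 A01 sum_mulr_delta row1 mulr0n subr0.
- under eq_bigr do rewrite A01 A12.
  under [X in _ + X]eq_bigr do rewrite A02 A22.
  by rewrite A00 A02 sum_mulr_delta addrAC row2 mulr0n subr0.
- under eq_bigr do rewrite A11 A10.
  under [X in _ + X]eq_bigr do rewrite A12 A20.
  by rewrite A00 A10 sum_mull_delta col1 mulr0n subr0.
- under eq_bigr do rewrite !A11.
  under [X in _ + X]eq_bigr do rewrite A12 A21.
  rewrite A11 A10 A01 sum_mull_delta eqSS.
  case: (altP (i =P k)) => [<-|ik].
    by rewrite eqxx !mulr1n diag1.
  by rewrite -val_eqE in ik; rewrite (negbTE ik) !mulr0n !mulr0 addr0 off1 ?subr0.
- under eq_bigr do rewrite A11 A12.
  under [X in _ + X]eq_bigr do rewrite A12 A22.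
  by rewrite A12 A10 A02 sum_mull_delta sum_mulr_delta corner1 noteq mulr0n subr0.
- under eq_bigr do rewrite A21 A10.
  under [X in _ + X]eq_bigr do rewrite A22 A20.
  by rewrite A00 A20 sum_mull_delta addrAC col2 mulr0n subr0.
- under eq_bigr do rewrite A21 A11.
  under [X in _ + X]eq_bigr do rewrite A22 A21.
  by rewrite A21 A20 A01 sum_mull_delta sum_mulr_delta addrAC corner2 eq_sym noteq mulr0n subr0.
- under eq_bigr do rewrite A21 A12.
  under [X in _ + X]eq_bigr do rewrite !A22.
  rewrite A22 A20 A02 sum_mull_delta eqm addrAC.
  case: (altP (j =P k)) => [<-|jk]; first by rewrite !mulr1n diag2.
  by rewrite !mulr0n !mulr0 addr0 off2 ?subr0.
Qed.

Lemma odd_family_quadratic :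
  let M := Bmx m a1 a2 b1 b2 b3 c + Cmx m a1 a2 b2 b3 c in
  (M - a1%:M) *m (M - a2%:M) = 0.
Proof.
move=> M; have ME i j : M i j = A i j by rewrite !mxE.
have -> : (M - a1%:M) *m (M - a2%:M) = M *m M - (a1 + a2) *: M + (a1 * a2)%:M.
  rewrite mulmxBl !mulmxBr mul_scalar_mx mul_mx_scalar -scalar_mxM scalerDl.
  by rewrite opprB opprD !addrA addrAC; congr (_ + _); apply: addrAC.
apply/matrixP => i j; rewrite !mxE; under eq_bigr do rewrite !ME.
by rewrite A_square ?ltn_ord // -/(A i j) val_eqE [X in X + _]addrAC subrr sub0r addNr.
Qed.

Lemma odd_family_trace :
  \tr (Bmx m a1 a2 b1 b2 b3 c + Cmx m a1 a2 b2 b3 c) = (m + 1)%:R * a1 + m%:R * a2.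
Proof.
rewrite /mxtrace; under eq_bigr do rewrite !mxE.
rewrite (sum_ord_split _ (fun k => A k k)) A00 trace_eq sum_c.
under eq_bigr do rewrite A11 eqxx mulr1n.
under [X in _ + X]eq_bigr do rewrite A22 eqxx mulr1n.
have E b (z : 'I_m -> F) : \sum_j (b + z j) = m%:R * b + \sum_j z j.
  by rewrite big_split /= sumr_const card_ord mulr_natl.
rewrite !E; set X := \sum_j x j; set Y := \sum_i y i; ring.
Qed.
End OddFamilyBlocks.

Unset Implicit Arguments.

Theorem theorem2p16 (C : numClosedFieldType) (m : nat) (a1 a2 b1 b2 b3 : C)
  (c : nat -> C) :
  (2 <= m)%N ->
  a1 != a2 ->
  b1 != b2 -> b1 != b3 -> b2 != b3 ->
  (forall i j : nat, (1 <= i <= 2 * m+1)%N -> (1 <= j <= 2 * m+1)%N ->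
     i != j -> c i != c j) ->
  (m+1)%:R * a1 + m%:R * a2 = b1 + m%:R * b2 + m%:R * b3 + \sum_(1 <= i < 2 * m+2) c i ->
  let A := Bmx m a1 a2 b1 b2 b3 c + Cmx m a1 a2 b2 b3 c in
  diagonalizable A /\
  char_poly A = ('X - a1%:P) ^+ (m+1) * ('X - a2%:P) ^+ m.
Proof.
move=> m_gt1 a12 _ _ _ c_inj trace_eq A.
have A_quadratic : (A - a1%:M) *m (A - a2%:M) = 0 by apply: odd_family_quadratic.
split; first exact: diagonalizable_quadratic a12 A_quadratic.
apply: (char_poly_quadratic a12 A_quadratic); first lia.
exact: odd_family_trace.
Qed.
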